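(* Let $(T_n)_{n\ge 0}$ be the Tribonacci sequence. The Diophantine equation $$(T_{n}+1)\cdots (T_{n+k-1}+1)\,(T_{n+k}-1) \cdots (T_{n+k+\ell-1}-1)=d\left(\frac{10^{m}-1}{9}\right)$$ has no solution in positive integers $n,k,\ell,m,d$ with $1\leq d\leq 9$ and $m\geq 2$.
   Context: The Tribonacci sequence is defined by $T_0=0$, $T_1=T_2=1$ and $T_{n+3}=T_{n+2}+T_{n+1}+T_n$ for all $n\ge 0$. The right-hand side $d(10^m-1)/9$ is the repdigit consisting of $m$ copies of the digit $d$. *)

(* Defs.v *)
From mathcomp Require Import all_boot.

Set Implicit Arguments.
Unset Strict Implicit.
Unset Printing Implicit Defensive.

Fixpoint trib (n : nat) : nat :=
  match n with
  | 0 => 0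
  | 1 => 1
  | 2 => 1
  | ((p.+1 as q).+1 as r).+1 => trib r + trib q + trib p
  end.

Lemma tribSSS n : trib n.+3 = trib n.+2 + trib n.+1 + trib n.
Proof. by []. Qed.

(* Both truncating operations of the main equation are exact: the factors
   [trib i - 1] only occur with [i >= 1], and 9 divides [10 ^ m - 1]. *)
Lemma trib_gt0 n : 0 < n -> 0 < trib n.
Proof.
case: n => // n _.
suff: (0 < trib n.+1) && (0 < trib n.+2) by case/andP.
by elim: n => // n /andP[h1 h2]; rewrite h2 tribSSS -addnA addn_gt0 h2.
Qed.

Definition repdigit (d m : nat) : nat := d * ((10 ^ m - 1) %/ 9).

Lemma dvdn9_repunit m : 9 %| 10 ^ m - 1.
Proof. by rewrite -eqn_mod_dvd ?expn_gt0 // -modnXm exp1n. Qed.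

(* Main.v *)
Require Import Defs.
From Stdlib Require Import NArith.
From mathcomp Require Import all_boot zify.

(* Among four consecutive indices exactly two have an odd Tribonacci number, and
   the corresponding factors are even; so with k + l >= 8 the product is
   divisible by 16, while 16 never divides a repdigit. For k + l <= 7 and
   m <= 3 the last factor bounds n by 13, which leaves finitely many cases. For
   k + l <= 7 and m >= 4 both sides are periodic modulo any modulus prime to 10
   (and modulo 16 and 625), and comparing them successively modulo 16, 5, 25,
   125, 625, 401, 311 and 61 eliminates every residue class of (n, m, d). The
   last three primes were found by search: their periods almost divide those
   already present, so the number of classes stays small. *)

Set Implicit Arguments.
Unset Strict Implicit.
Unset Printing Implicit Defensive.

(** * Repunits and products of shifted Tribonacci numbers *)

Definition repunit m := (10 ^ m - 1) %/ 9.

Lemma repunitS m : repunit m.+1 = 10 * repunit m + 1.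
Proof.
rewrite /repunit expnS.
have /dvdnP[q hq] := dvdn9_repunit m.
have h : 0 < 10 ^ m by rewrite expn_gt0.
have -> : 10 * 10 ^ m - 1 = (10 * q + 1) * 9 by lia.
by rewrite hq !mulnK.
Qed.

(** The list encodes the shape of the product by signs, [true] for +1 and [false] for -1, so that
    both kinds of factors fall under one recursion. *)
Fixpoint window_prod (w : seq bool) (n : nat) : nat :=
  if w is e :: w' then
    (if e then trib n + 1 else trib n - 1) * window_prod w' n.+1
  else 1.

Definition window k l := nseq k true ++ nseq l false.

Lemma window_prod_cat u v n :
  window_prod (u ++ v) n = window_prod u n * window_prod v (n + size u).
Proof.
elim: u n => [|e u IH] n /=; first by rewrite mul1n addn0.
by rewrite IH mulnA addSnnS.
Qed.

Lemma window_prod_true k n :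
  window_prod (nseq k true) n = \prod_(n <= i < n + k) (trib i + 1).
Proof.
elim: k n => [|k IH] n /=; first by rewrite addn0 big_geq.
by rewrite IH addSnnS [RHS]big_ltn // addnS ltnS leq_addr.
Qed.

Lemma window_prod_false l n :
  window_prod (nseq l false) n = \prod_(n <= i < n + l) (trib i - 1).
Proof.
elim: l n => [|l IH] n /=; first by rewrite addn0 big_geq.
by rewrite IH addSnnS [RHS]big_ltn // addnS ltnS leq_addr.
Qed.

Lemma window_prodE n k l :
  window_prod (window k l) n =
  \prod_(n <= i < n + k) (trib i + 1) *
    \prod_(n + k <= i < n + k + l) (trib i - 1).
Proof.
by rewrite window_prod_cat window_prod_true window_prod_false size_nseq.
Qed.

(** * Parity and divisibility by 16 *)

Lemma odd_trib n : odd (trib n) = (n %% 4 \in [:: 1; 2]).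
Proof.
suff h q : [/\ odd (trib (4 * q)) = false, odd (trib (4 * q).+1),
               odd (trib (4 * q).+2) & odd (trib (4 * q).+3) = false].
  rewrite {1}(divn_eq n 4) mulnC; have := ltn_pmod n (isT : 0 < 4).
  have [h0 h1 h2 h3] := h (n %/ 4).
  by case: (n %% 4) => [|[|[|[|]]]] // _;
    rewrite ?addn0 ?addn1 ?addn2 ?addn3 ?h0 ?h1 ?h2 ?h3.
have oS i : odd (trib i.+3) =
    odd (trib i.+2) (+) odd (trib i.+1) (+) odd (trib i).
  by rewrite tribSSS oddD; congr (_ (+) _); exact: oddD.
elim: q => // q [h0 h1 h2 h3].
have -> : 4 * q.+1 = (4 * q).+4 by lia.
have o4 : odd (trib (4 * q).+4) = false by rewrite oS h1 h2 h3.
have o5 : odd (trib (4 * q).+4.+1) by rewrite oS o4 h2 h3.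
have o6 : odd (trib (4 * q).+4.+2) by rewrite oS o4 o5 h3.
by split => //; rewrite oS o4 o5 o6.
Qed.

Lemma dvd4_window_prod w n : size w = 4 -> 0 < n -> 4 %| window_prod w n.
Proof.
case: w => [|e1 [|e2 [|e3 [|e4 []]]]] //= _ n0.
have fac (e : bool) i : odd (trib i) ->
    2 %| (if e then trib i + 1 else trib i - 1).
  by move=> oi; case: e; lia.
have two i j a b : odd (trib i) -> odd (trib j) -> 
    4 %| (if a then trib i + 1 else trib i - 1) *
           (if b then trib j + 1 else trib j - 1).
  by move=> oi oj; apply: (@dvdn_mul 2 2); apply: fac.
set f1 := if e1 then _ else _; set f2 := if e2 then _ else _.
set f3 := if e3 then _ else _; set f4 := if e4 then _ else _.
rewrite muln1.
(* The residue of [n] modulo 4 decides which two factors are even; the product is regrouped around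
   them. *)
have [r1|[r2|[r3|r0]]] :
    n %% 4 = 1 \/ n %% 4 = 2 \/ n %% 4 = 3 \/ n %% 4 = 0 by lia.
- have -> : f1 * (f2 * (f3 * f4)) = f1 * f2 * (f3 * f4) by lia.
  by apply: dvdn_mulr; apply: (two n n.+1 e1 e2); rewrite odd_trib !inE; lia.
- have -> : f1 * (f2 * (f3 * f4)) = f1 * f4 * (f2 * f3) by lia.
  by apply: dvdn_mulr; apply: (two n n.+3 e1 e4); rewrite odd_trib !inE; lia.
- have -> : f1 * (f2 * (f3 * f4)) = f3 * f4 * (f1 * f2) by lia.
  by apply: dvdn_mulr; apply: (two n.+2 n.+3 e3 e4); rewrite odd_trib !inE; lia.
- have -> : f1 * (f2 * (f3 * f4)) = f2 * f3 * (f1 * f4) by lia.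
  by apply: dvdn_mulr; apply: (two n.+1 n.+2 e2 e3); rewrite odd_trib !inE; lia.
Qed.

Lemma dvd16_window_prod w n : 8 <= size w -> 0 < n -> 16 %| window_prod w n.
Proof.
move=> hw n0; rewrite -(cat_take_drop 4 w) window_prod_cat.
rewrite -(cat_take_drop 4 (drop 4 w)) window_prod_cat mulnA.
apply: dvdn_mulr; apply: (@dvdn_mul 4 4); apply: dvd4_window_prod => //;
  by rewrite ?size_takel ?size_drop //; lia.
Qed.

Lemma ndvd16_repdigit d m : 0 < m -> 1 <= d <= 9 -> ~~ (16 %| repdigit d m).
Proof.
case: m => // m _ hd; rewrite /repdigit -/(repunit _) repunitS.
(* The repunit is odd, so 16 would have to divide [d]. *)
rewrite mulnC (@Gauss_dvdr 16 (10 * repunit m + 1)); first by lia.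
by rewrite (@coprime_pexpl 4 2) // coprime2n; lia.
Qed.

(** * Residues computed as orbits in binary arithmetic *)

Definition trib_step (M : N) (s : N * N * N) :=
  let '(a, b, c) := s in (b, c, ((a + b + c) mod M)%num).

Definition trib_start : N * N * N := (0%num, 1%num, 1%num).

Definition repunit_step (M r : N) := ((10 * r + 1) mod M)%num.

(** Adding [M - 1] replaces subtracting 1, which would truncate at residue 0. *)
Fixpoint window_prod_mod (M : N) (w : seq bool) (s : N * N * N) : N :=
  if w is e :: w' then
    ((s.1.1 + (if e then 1 else M - 1)) *
       window_prod_mod M w' (trib_step M s) mod M)%num
  else (1 mod M)%num.

Lemma addN_mod (M a b : N) : ((a mod M + b mod M) mod M = (a + b) mod M)%num.
Proof. by rewrite -N.Div0.add_mod. Qed.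

Lemma iter_trib_step M n : (1 < M)%num ->
  iter n (trib_step M) trib_start =
  (N.of_nat (trib n) mod M, N.of_nat (trib n.+1) mod M,
   N.of_nat (trib n.+2) mod M)%num.
Proof.
move=> M1; elim: n => [|n IH].
  by rewrite /= !N.mod_small //; lia.
rewrite iterS IH /trib_step; congr (_, _).
rewrite N.Div0.add_mod_idemp_r -N.Div0.add_mod_idemp_l addN_mod.
rewrite N.Div0.add_mod_idemp_l tribSSS.
by congr (_ mod _)%num; lia.
Qed.

Lemma window_prod_modE M w n : (1 < M)%num -> 0 < n ->
  window_prod_mod M w (iter n (trib_step M) trib_start) =
  (N.of_nat (window_prod w n) mod M)%num.
Proof.
move=> M1; elim: w n => [|e w IH] n n0 //=.
rewrite -iterS IH // {1}iter_trib_step //= N.Div0.mul_mod_idemp_r.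
rewrite -N.Div0.mul_mod_idemp_l N.Div0.add_mod_idemp_l.
rewrite Nat2N.inj_mul -[RHS]N.Div0.mul_mod_idemp_l.
congr ((_ * _) mod _)%num; case: e; first by congr (_ mod _)%num; lia.
(* Positivity makes [trib n - 1] exact, so the two forms of the factor differ by [M]. *)
have t0 := trib_gt0 n0.
have -> : (N.of_nat (trib n) + (M - 1) = N.of_nat (trib n - 1) + 1 * M)%num.
  by lia.
by rewrite N.Div0.mod_add.
Qed.

(* The orbit starts at the repunit 1111, since repunits with at least four
   digits are constant modulo 16 and modulo 625, hence purely periodic for every
   modulus of the sieve. *)
Lemma iter_repunit_step M j :
  iter j (repunit_step M) (1111 mod M)%num =
  (N.of_nat (repunit (j + 4)) mod M)%num.
Proof.
elim: j => [|j IH]; first by rewrite !repunitS.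
rewrite iterS IH /repunit_step addSn repunitS.
rewrite -N.Div0.add_mod_idemp_l N.Div0.mul_mod_idemp_r N.Div0.add_mod_idemp_l.
by congr (_ mod _)%num; lia.
Qed.

(** * Periodic orbits and the sieve *)

Lemma iter_periodic (A : Type) (f : A -> A) (x : A) (P n : nat) :
  iter P f x = x -> iter (n %% P) f x = iter n f x.
Proof.
move=> hP; rewrite [in RHS](divn_eq n P) addnC iterD.
by congr (iter _ _ _); elim: (n %/ P) => // q IH; rewrite mulSn iterD -IH.
Qed.

Lemma N_of_nat_modn n P : 0 < P ->
  N.of_nat (n %% P) = (N.of_nat n mod N.of_nat P)%num.
Proof.
move=> P0; rewrite [in RHS](divn_eq n P) addnC Nat2N.inj_add Nat2N.inj_mul.
by rewrite N.Div0.mod_add N.mod_small //; have := ltn_pmod n P0; lia.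
Qed.

Definition lookup (tab : seq N) (P : nat) (r : N) : N :=
  nth 0%num tab (N.to_nat (r mod N.of_nat P)%num).

(** As [P] divides [Q], the class of [n] modulo [Q] determines [n %% P]; the table holds one full
    period, so the default of [nth] is never returned. *)
Lemma lookup_orbit (A : Type) (f : A -> A) (g : A -> N) x (P n : nat) (Q : N) :
  0 < P -> iter P f x = x -> (Q mod N.of_nat P = 0)%num ->
  lookup [seq g y | y <- traject f x P] P (N.of_nat n mod Q)%num =
  g (iter n f x).
Proof.
move=> P0 hP hQ; rewrite /lookup.
have -> : ((N.of_nat n mod Q) mod N.of_nat P = N.of_nat (n %% P))%num.
  rewrite N_of_nat_modn //; have -> : Q = (N.of_nat P * (Q / N.of_nat P))%num.
    by rewrite {1}(N.Div0.div_mod Q (N.of_nat P)) hQ N.add_0_r.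
  by rewrite N.Div0.mod_mul_r N.mul_comm N.Div0.mod_add N.Div0.mod_mod.
rewrite Nat2N.id (nth_map x) ?size_traject ?ltn_pmod //.
by rewrite nth_traject ?ltn_pmod // iter_periodic.
Qed.

(* One step of the sieve: a modulus [M], the periods [P] and [o] of the
   Tribonacci sequence and of the repunits modulo [M], and the factors [a] and
   [b] by which the current moduli for [n] and [m] are refined. *)
Definition sieve_step := (N * (nat * nat) * (nat * nat))%type.

Definition lifts (Q : N) (a : nat) (r : N) : seq N :=
  [seq (r + Q * N.of_nat u)%num | u <- iota 0 a].

Lemma mem_lifts Q a n : 0 < a ->
  (N.of_nat n mod (Q * N.of_nat a))%num \in lifts Q a (N.of_nat n mod Q)%num.
Proof.
move=> a0; rewrite N.Div0.mod_mul_r.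
(* The chosen lift is given by the next mixed-radix digit of [n]. *)
set q := (_ / _)%num; apply/mapP; exists (N.to_nat (q mod N.of_nat a)).
  have : (q mod N.of_nat a < N.of_nat a)%num by apply: N.mod_lt; lia.
  by rewrite mem_iota; move: (_ mod _)%num => r; lia.
by rewrite N2Nat.id.
Qed.

(* The residue classes [(n mod Q, j mod O, d)] still possible for a solution
   with [m = j + 4] are kept in [L]. *)
Fixpoint sieve (w : seq bool) (qs : seq sieve_step) (Q O : N)
    (L : seq (N * N * N)) : bool :=
  if qs is (M, (P, o), (a, b)) :: qs' then
    let Q' := (Q * N.of_nat a)%num in
    let O' := (O * N.of_nat b)%num in
    let T :=
      [seq window_prod_mod M w s | s <- traject (trib_step M) trib_start P] in
    let R := [seq r | r <- traject (repunit_step M) (1111 mod M)%num o] in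
    [&& (1 <? M)%num, 0 < P, 0 < o, 0 < a, 0 < b,
        (Q' mod N.of_nat P == 0)%num, (O' mod N.of_nat o == 0)%num,
        iter P (trib_step M) trib_start == trib_start,
        iter o (repunit_step M) (1111 mod M)%num == (1111 mod M)%num
      & sieve w qs' Q' O'
          [seq x <- [seq (rs, t.2) | t <- L,
              rs <- [seq (r, s) | r <- lifts Q a t.1.1, s <- lifts O b t.1.2]]
             | lookup T P x.1.1 == (x.2 * lookup R o x.1.2 mod M)%num]]
  else nilp L.

(** A solution satisfies the congruence tested at every step, so its class, once listed, would
    survive until the final list, which is empty. *)
Lemma sieve_sound w qs Q O L n j d : 0 < n -> sieve w qs Q O L ->
  window_prod w n = repdigit d (j + 4) ->
  (N.of_nat n mod Q, N.of_nat j mod O, N.of_nat d)%num \notin L.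
Proof.
move=> n0; elim: qs Q O L => [|[[M [P o]] [a b]] qs IH] Q O L.
  by move=> /nilP ->.
rewrite [sieve _ _ _ _ _]/=.
case/andP=> /N.ltb_spec0 M1 /andP[P0] /andP[o0] /andP[a0] /andP[b0].
case/andP=> /eqP hQ /andP[/eqP hO] /andP[/eqP hP] /andP[/eqP ho] hs sol.
apply/negP => hL; have /negP := IH _ _ _ hs sol; apply.
rewrite mem_filter; apply/andP; split.
  rewrite /fst /snd !lookup_orbit // window_prod_modE // iter_repunit_step sol.
  by rewrite N.Div0.mul_mod_idemp_r -Nat2N.inj_mul.
apply/allpairsPdep; exists (N.of_nat n mod Q, N.of_nat j mod O, N.of_nat d)%num.
exists (N.of_nat n mod (Q * N.of_nat a), N.of_nat j mod (O * N.of_nat b))%num.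
by split=> //; apply/allpairsPdep; do 2!eexists; split; last first;
  [| exact: mem_lifts | exact: mem_lifts].
Qed.

(** The first five steps refine only [n], the repunits being constant there; 401 and 311 refine only
    [m], since 400 and 310 divide the modulus 124000 reached for [n]. *)
Definition sieve_steps : seq sieve_step :=
  [:: (16%num, (32, 1), (32, 1)); (5%num, (31, 1), (31, 1));
      (25%num, (155, 1), (5, 1)); (125%num, (775, 1), (5, 1));
      (625%num, (3875, 1), (5, 1)); (401%num, (400, 200), (1, 200));
      (311%num, (310, 155), (1, 31)); (61%num, (1860, 60), (3, 3))].

Definition short_windows : seq (seq bool) :=
  [seq window kl.1 kl.2 | kl <- [seq (k, l) | k <- iota 1 6, l <- iota 1 (7 - k)]].

Lemma mem_short_windows k l :
  0 < k -> 0 < l -> k + l <= 7 -> window k l \in short_windows.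
Proof.
move=> k0 l0 kl; apply/mapP; exists (k, l) => //.
by apply/allpairsPdep; exists k, l; rewrite !mem_iota; split=> //; lia.
Qed.

Lemma sieve_short_windows :
  all (fun w => sieve w sieve_steps 1 1
    [seq (0%num, 0%num, N.of_nat d) | d <- iota 1 9]) short_windows.
Proof. by vm_compute. Qed.

(** * Two or three digits, and the conclusion *)

Lemma leq_trib i j : i <= j -> trib i <= trib j.
Proof.
apply: (homo_leq (@leqnn) (@leq_trans)) => {i j} -[|[|i]] //.
by rewrite tribSSS -addnA leq_addr.
Qed.

Lemma last_factor_le n k l : 0 < l -> 0 < window_prod (window k l) n ->
  trib (n + k + l).-1 <= (window_prod (window k l) n).+1.
Proof.
case: l => // l _; rewrite /window -[l.+1]addn1 nseqD catA window_prod_cat /=.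
rewrite size_cat !size_nseq muln1 addn1 addnS /= addnA.
by case: (window_prod _ _) => // q; lia.
Qed.

(** Residues modulo 1000 already separate the two sides, and spare the evaluation of large products
    in unary. *)
Lemma small_windows_mod :
  all (fun w => all (fun n => all (fun d => all (fun r =>
    window_prod_mod 1000 w (iter n (trib_step 1000) trib_start) !=
      (N.of_nat (d * r) mod 1000)%num)
    [:: 11; 111]) (iota 1 9)) (iota 1 13)) short_windows.
Proof. by vm_compute. Qed.

Lemma repunitE2 : repunit 2 = 11.
Proof. by rewrite !repunitS. Qed.

Lemma repunitE3 : repunit 3 = 111.
Proof. by rewrite !repunitS. Qed.

Theorem theorem4 (n k l m d : nat)
    (hn : 0 < n) (hk : 0 < k) (hl : 0 < l)
    (hd : 1 <= d <= 9) (hm : 2 <= m) :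
  (\prod_(n <= i < n + k) (trib i + 1)) *
    (\prod_(n + k <= i < n + k + l) (trib i - 1)) <> repdigit d m.
Proof.
rewrite -window_prodE => sol.
have [kl8|kl7] := leqP 8 (k + l).
  have := ndvd16_repdigit (ltnW hm) hd.
  by rewrite -sol dvd16_window_prod // size_cat !size_nseq.
have hw : window k l \in short_windows by apply: mem_short_windows.
have hd9 : d \in iota 1 9 by rewrite mem_iota.
have [m4|m3] := leqP 4 m.
  have /negP := sieve_sound hn (allP sieve_short_windows _ hw)
                  (etrans sol (congr1 _ (esym (subnK m4)))).
  (* The sieve starts with both moduli 1, so the class of the solution is [(0, 0, d)]. *)
  apply; rewrite !N.mod_1_r; exact: map_f.
have hr : repunit m \in [:: 11; 111].
  by case: m hm m3 {sol} => [|[|[|[|]]]] // _ _; rewrite ?repunitE2 ?repunitE3.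
have sol' : window_prod (window k l) n = d * repunit m by [].
(* The product is at most 9 * 111 = 999, and its last factor is a Tribonacci number minus 1. *)
have hle : trib (n + k + l).-1 <= 1000.
  have r0 : 0 < repunit m <= 111 by move: hr; rewrite !inE => /orP[] /eqP->.
  apply: leq_trans (last_factor_le hl _) _; rewrite sol'; nia.
have hn13 : n \in iota 1 13.
  (* The bound fails from index 14 on, as [trib 14] is 1705. *)
  rewrite mem_iota hn /= ltnNge; apply/negP => n14.
  have := leq_trans (@leq_trib 14 (n + k + l).-1 _) hle.
  by move=> /(_ ltac:(lia)).
have /allP/(_ _ hn13)/allP/(_ _ hd9)/allP/(_ _ hr) :=
  allP small_windows_mod _ hw.
by rewrite window_prod_modE // sol' eqxx.
Qed.
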